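(* Let $(B_n)_{n\ge0}$ be the balancing numbers. Let $(a,b,c,d)\in\{(1,1,1,1),(1,1,1,3),(1,1,2,2),(1,1,2,4),(1,1,5,5),(1,2,3,6)\}$. If $(x,y,z)=(B_i,B_j,B_k)$ with integers $i,j,k\ge1$ is a solution of $ax^2+by^2+cz^2=dxyz$, then $x=y=z=B_1=1$. (That is, there is at most one such solution, namely $(1,1,1)$.)
   Context: The balancing numbers are defined by $B_0=0$, $B_1=1$, $B_n=6B_{n-1}-B_{n-2}$ for $n\ge2$. *)

(* Defs.v *)
From mathcomp Require Import all_boot all_order all_algebra.
Set Implicit Arguments.
Unset Strict Implicit.
Unset Printing Implicit Defensive.

Import GRing.Theory.
Local Open Scope ring_scope.

(* The values are in int, so that the subtraction is not truncated. *)
Fixpoint balancing (n : nat) : int :=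
  match n with
  | 0%N => 0
  | 1%N => 1
  | (m.+1 as p).+1 => 6 * balancing p - balancing m
  end.

Definition markov_coefs : seq (int * int * int * int) :=
  [:: (1, 1, 1, 1); (1, 1, 1, 3); (1, 1, 2, 2);
      (1, 1, 2, 4); (1, 1, 5, 5); (1, 2, 3, 6)].

(* Main.v *)
(**
Sort the indices, i <= j <= k, permuting (a, b, c) accordingly.  The addition
formula B_{m+n+1} = B_{m+1} B_{n+1} - B_m B_n gives
B_{i+j-1} <= B_i B_j and B_{i+j} > 5 B_i B_j.  If k >= i + j, then z > 5xy,
while the equation forces cz < dxy; this is absurd unless d > 5c, that is c = 1
and d = 6, where k = i + j and the conjugate root
6xy - z = x B_{j-1} + y B_{i-1} makes the product of the roots differ from
ax^2 + by^2.
If k < i + j, then z <= xy.  When d = a + b + c, this gives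
d xyz >= (a + b + c) z^2, so x = y = z = 1.  In the other cases k <= i + j - 2
is impossible because then 5z <= xy, and k = i + j - 1 is excluded by the exact
value z = xy - B_{i-1} B_{j-1}.
*)
Require Import Defs.
From mathcomp Require Import all_boot all_order all_algebra.
From mathcomp Require Import zify ring.
Import Order.TTheory GRing.Theory Num.Theory.
Local Open Scope ring_scope.

(** * Growth and addition formulas *)

Lemma balancingSS n : balancing n.+2 = 6 * balancing n.+1 - balancing n.
Proof. by []. Qed.

Lemma balancing_ratio n : 0 <= balancing n /\ 5 * balancing n < balancing n.+1.
Proof.
elim: n => [|n [IH0 IH1]]; first by [].
by rewrite balancingSS; split; lia.
Qed.

Lemma balancingS_gt0 n : 0 < balancing n.+1.
Proof. by have := balancing_ratio n; lia. Qed.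

Lemma balancing_le m n : (m <= n)%N -> balancing m <= balancing n.
Proof.
elim: n => [|n IH]; first by rewrite leqn0 => /eqP ->.
rewrite leq_eqVlt => /orP[/eqP -> //|/IH le_mn].
by have := balancing_ratio n; lia.
Qed.

Lemma balancing_addS m n :
  balancing (m + n).+1
    = balancing m.+1 * balancing n.+1 - balancing m * balancing n.
Proof.
(* The recurrence has order two, so the induction carries two consecutive values. *)
suff: balancing (m + n).+1
        = balancing m.+1 * balancing n.+1 - balancing m * balancing n /\
      balancing (m + n).+2
        = balancing m.+2 * balancing n.+1 - balancing m.+1 * balancing n by case.
elim: m => [|m [IH1 IH2]].
  by rewrite !add0n (balancingSS n) (_ : balancing 2 = 6) //=; split; ring.
rewrite addSn; split=> //.
rewrite balancingSS IH2 IH1 (balancingSS m.+1) (balancingSS m); ring.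
Qed.

Lemma balancing_cassini n :
  balancing n.+2 * balancing n = balancing n.+1 ^+ 2 - 1.
Proof.
elim: n => [|n IH]; first by [].
rewrite balancingSS.
have := IH; rewrite balancingSS; lia.
Qed.

(** For [x = B_{m+1}], [y = B_{n+1}] and [z = B_{m+n+2}], the subtracted terms add up to the
    conjugate root [6xy - z]. *)
Lemma balancing_addSS m n :
  balancing (m + n).+2 = 6 * (balancing m.+1 * balancing n.+1)
    - balancing m * balancing n.+1 - balancing m.+1 * balancing n.
Proof. rewrite -addSn balancing_addS balancingSS; ring. Qed.

(** Each term subtracted in [balancing_addSS] is below a fifth of the product, and [6 - 2/5 > 5]. *)
Lemma balancing_addSS_gt m n :
  5 * (balancing m.+1 * balancing n.+1) < balancing (m + n).+2.
Proof.
have x0 := balancingS_gt0 m; have y0 := balancingS_gt0 n.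
have [_ px] := balancing_ratio m; have [_ qy] := balancing_ratio n.
rewrite balancing_addSS.
have := ltr_pM2r y0 (5 * balancing m) (balancing m.+1).
have := ltr_pM2l x0 (5 * balancing n) (balancing n.+1).
by rewrite px qy; have := mulr_gt0 x0 y0; lia.
Qed.

(** * The range [i + j < k] *)

(* Indices are shifted by one from here on: x = B_{i+1}, y = B_{j+1}, z = B_{k+1}. *)
Lemma balancing_ne_large a b c d i j k :
  0 < a -> 0 < b -> 0 < c ->
  d <= 5 * c \/ [/\ c = 1, d = 6, a <= 3 & b <= 3] ->
  (i <= j)%N -> (i + j < k)%N ->
  a * balancing i.+1 ^+ 2 + b * balancing j.+1 ^+ 2 + c * balancing k.+1 ^+ 2
    <> d * balancing i.+1 * balancing j.+1 * balancing k.+1.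
Proof.
move=> a0 b0 c0 hd hij hk heq.
have x0 := balancingS_gt0 i; have y0 := balancingS_gt0 j.
have z0 := balancingS_gt0 k; have w5 := balancing_addSS_gt i j.
have xy0 := mulr_gt0 x0 y0.
have wz : balancing (i + j).+2 <= balancing k.+1 by apply: balancing_le.
have cz : c * balancing k.+1 < d * (balancing i.+1 * balancing j.+1).
  rewrite -subr_gt0 -(pmulr_rgt0 _ z0).
  have -> : balancing k.+1 * (d * (balancing i.+1 * balancing j.+1)
       - c * balancing k.+1) = a * balancing i.+1 ^+ 2 + b * balancing j.+1 ^+ 2.
    by move: heq; lia.
  by rewrite addr_gt0 // mulr_gt0 // exprn_gt0.
case: hd => [d5|[c1 d6 a3 b3]].
  have h1 := ler_pM2r xy0 d (5 * c); rewrite d5 in h1.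
  have h2 := ltr_pM2l c0 (5 * (balancing i.+1 * balancing j.+1)) (balancing k.+1).
  by rewrite (lt_le_trans w5 wz) in h2; lia.
subst c d.
(* By [cz], [z < 6xy]; one index beyond [i + j + 1], [z] would exceed [25xy]. *)
have [/balancing_le wk|le_k] := leqP (i + j).+3 k.+1.
  by have := balancing_ratio (i + j).+2; lia.
have ek : k = (i + j).+1 by lia.
subst k => {hk wz le_k z0}.
have e := balancing_addSS i j.
(* Vieta: the two roots in [z] have product [ax^2 + by^2]. *)
have {heq} prod : balancing (i + j).+2
    * (balancing i * balancing j.+1 + balancing i.+1 * balancing j)
    = a * balancing i.+1 ^+ 2 + b * balancing j.+1 ^+ 2.
  have -> : balancing i * balancing j.+1 + balancing i.+1 * balancing j
     = 6 * (balancing i.+1 * balancing j.+1) - balancing (i + j).+2 by lia.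
  by lia.
(* For [i = 0], Cassini's identity turns [prod] into [y^2 - 1 = a + by^2]. *)
case: i => [|i] in hij x0 w5 xy0 cz e prod *.
  rewrite add0n mul0r add0r mul1r balancing_cassini expr1n mulr1 in prod.
  have y2 := exprn_gt0 2 y0.
  by have := ler_pM2r y2 1 b; lia.
case: j => [//|j] in hij y0 w5 xy0 cz e prod *.
have p0 := balancingS_gt0 i; have q0 := balancingS_gt0 j.
move: x0 y0 p0 q0 w5 xy0 prod {e cz}.
set x := balancing i.+2; set y := balancing j.+2.
set p := balancing i.+1; set q := balancing j.+1; set w := balancing _.
move=> x0 y0 p0 q0 w5 xy0 prod.
(* Now [p, q >= 1], so the product of the roots is at least [5xy(x + y)], more than
   [3x^2 + 3y^2]. *)
have : 5 * (x * y) * (y + x) <= w * (p * y + x * q).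
  by apply: ler_pM; [lia | lia | lia | apply: lerD; nia].
have : x ^+ 2 <= x * y * x by nia.
have : y ^+ 2 <= x * y * y by nia.
have := ler_pM2r (exprn_gt0 2 x0) a 3.
have := ler_pM2r (exprn_gt0 2 y0) b 3.
have := exprn_gt0 2 y0.
by rewrite a3 b3; nia.
Qed.

(** * The range [k <= i + j] *)

Lemma balancing_addS_le m n :
  balancing (m + n).+1 <= balancing m.+1 * balancing n.+1.
Proof.
have [p0 _] := balancing_ratio m; have [q0 _] := balancing_ratio n.
by rewrite balancing_addS; have := mulr_ge0 p0 q0; lia.
Qed.

(** As [z] is the largest and [5z <= xy], the left side is at most
    [(a + b + c)z^2 < 5dz^2 <= dxyz]. *)
Lemma balancing_ne_small a b c d i j k :
  0 < a -> 0 < b -> 0 < c -> a + b + c < 5 * d ->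
  (i <= j <= k)%N -> (k < i + j)%N ->
  a * balancing i.+1 ^+ 2 + b * balancing j.+1 ^+ 2 + c * balancing k.+1 ^+ 2
    <> d * balancing i.+1 * balancing j.+1 * balancing k.+1.
Proof.
move=> a0 b0 c0 hd /andP[hij hjk] hk.
have x0 := balancingS_gt0 i; have y0 := balancingS_gt0 j.
have xy : balancing i.+1 <= balancing j.+1 by apply: balancing_le.
have yz : balancing j.+1 <= balancing k.+1 by apply: balancing_le.
have zw : balancing k.+1 <= balancing (i + j) by apply: balancing_le.
have := balancing_addS_le i j.
have [_] := balancing_ratio (i + j).
move: x0 y0 xy yz zw.
set x := balancing i.+1; set y := balancing j.+1; set z := balancing k.+1.
move=> x0 y0 xy yz zw w5 wxy heq.
have z0 : 0 < z by lia.
have xz : x ^+ 2 <= z ^+ 2 by nia.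
have yz2 : y ^+ 2 <= z ^+ 2 by nia.
have zz : 5 * z ^+ 2 <= x * y * z by nia.
have d0 : 0 < d by lia.
have := ler_pM2l a0 (x ^+ 2) (z ^+ 2).
have := ler_pM2l b0 (y ^+ 2) (z ^+ 2).
have := ler_pM2l d0 (5 * z ^+ 2) (x * y * z).
have := ltr_pM2r (exprn_gt0 2 z0) (a + b + c) (5 * d).
by rewrite xz yz2 zz hd; lia.
Qed.

Lemma markov_balancing_mid a b c d i j k :
  0 < a -> 0 < b -> 0 < c -> d = a + b + c ->
  (i <= j <= k)%N -> (k <= i + j)%N ->
  a * balancing i.+1 ^+ 2 + b * balancing j.+1 ^+ 2 + c * balancing k.+1 ^+ 2
    = d * balancing i.+1 * balancing j.+1 * balancing k.+1 ->
  balancing k.+1 = 1.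
Proof.
move=> a0 b0 c0 -> /andP[hij hjk] hk.
have x0 := balancingS_gt0 i; have y0 := balancingS_gt0 j.
have xy : balancing i.+1 <= balancing j.+1 by apply: balancing_le.
have yz : balancing j.+1 <= balancing k.+1 by apply: balancing_le.
have zw : balancing k.+1 <= balancing (i + j).+1 by apply: balancing_le.
have := le_trans zw (balancing_addS_le i j).
move: x0 y0 xy yz {zw}.
set x := balancing i.+1; set y := balancing j.+1; set z := balancing k.+1.
move=> x0 y0 xy yz zxy heq.
have z0 : 0 < z by lia.
have yz2 : y ^+ 2 <= z ^+ 2 by nia.
have zz : z ^+ 2 <= x * y * z by nia.
have d0 : 0 < a + b + c by lia.
(* From [dz^2 <= ax^2 + by^2 + cz^2] and [y <= z] there remains [az^2 <= ax^2]. *)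
have xz : z ^+ 2 <= x ^+ 2.
  have := ler_pM2l b0 (y ^+ 2) (z ^+ 2).
  have := ler_pM2l d0 (z ^+ 2) (x * y * z).
  by rewrite yz2 zz -(ler_pM2l a0 (z ^+ 2)); lia.
have ex : x = z by nia.
have ey : y = z by lia.
rewrite ex ey in heq.
have : (a + b + c) * z ^+ 2 * (z - 1) = 0 by lia.
by move/eqP; rewrite !mulf_eq0; have := exprn_gt0 2 z0; lia.
Qed.

(** With [d = c] the equation reads [cz(xy - z) = x^2 + y^2], where [xy - z = B_i B_j]. The left
    side vanishes for [i = 0] and is at least [25y^2] for [i >= 2]. *)
Lemma balancing_ne_diag_eq c i j :
  c \in [:: 1; 2; 5] -> (i <= j)%N ->
  balancing i.+1 ^+ 2 + balancing j.+1 ^+ 2 + c * balancing (i + j).+1 ^+ 2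
    <> c * balancing i.+1 * balancing j.+1 * balancing (i + j).+1.
Proof.
move=> hc hij heq.
have {heq} prod : c * (balancing (i + j).+1 * (balancing i * balancing j))
    = balancing i.+1 ^+ 2 + balancing j.+1 ^+ 2.
  have -> : balancing i * balancing j
     = balancing i.+1 * balancing j.+1 - balancing (i + j).+1.
    by rewrite balancing_addS; ring.
  by lia.
have c1 : 1 <= c by move: hc; rewrite !inE => /or3P[] /eqP ->.
have x0 := balancingS_gt0 i; have y0 := balancingS_gt0 j.
have xy : balancing i.+1 <= balancing j.+1 by apply: balancing_le.
case: i => [|[|i]] in hij x0 xy prod *.
- by rewrite mul0r !mulr0 in prod; have := exprn_gt0 2 y0; lia.
(* Here [x = 6] and the equation becomes [c(y^2 - 1) = 36 + y^2], which has no solution with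
   [y >= 6]. *)
- rewrite mul1r add1n balancing_cassini in prod.
  rewrite (_ : balancing 2 = 6) // in prod xy x0.
  move: hc xy prod; rewrite !inE; set y := balancing _.
  have [->|y7] : y = 6 \/ (y < 6) || (7 <= y) by lia.
    by case/or3P => /eqP ->.
  move=> hc xy; have : 7 * 7 <= y ^+ 2 by nia.
  by case/or3P: hc => /eqP ->; lia.
case: j => [//|j] in hij y0 xy prod *.
have zy : 25 * balancing j.+2 <= balancing (i.+2 + j.+1).+1.
  have : balancing j.+4 <= balancing (i.+2 + j.+1).+1 by apply: balancing_le; lia.
  by have := balancing_ratio j.+2; have := balancing_ratio j.+3; lia.
have p6 : 6 <= balancing i.+2 by apply: (@balancing_le 2).
have qy : balancing j.+2 <= 6 * balancing j.+1.
  by rewrite balancingSS; have := balancing_ratio j; lia.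
have pq : balancing j.+2 <= balancing i.+2 * balancing j.+1.
  by have := ler_pM2r (balancingS_gt0 j) 6 (balancing i.+2); rewrite p6; lia.
move: prod xy x0 y0 zy pq {p6 qy}.
set x := balancing i.+3; set y := balancing j.+2.
set z := balancing (i.+2 + j.+1).+1; set t := balancing i.+2 * balancing j.+1 => prod xy x0 y0 zy pq.
have h1 : 25 * y * y <= z * t by apply: ler_pM; lia.
have h2 : x ^+ 2 <= y ^+ 2 by nia.
have := exprn_gt0 2 y0.
have zt0 : 0 < z * t by rewrite mulr_gt0; lia.
have := ler_pM2r zt0 1 c.
by rewrite c1; lia.
Qed.

(** For [i >= 1], the bounds [z <= xy], [x >= 6] and [z >= 5y] give
    [dxyz - z^2 >= (d - 1)xyz >= 30(d - 1)y^2], which exceeds [(a + b)y^2]. *)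
Lemma balancing_ne_diag_lt a b d i j :
  (a, b, d) \in [:: (1, 2, 2); (2, 1, 2); (1, 5, 5); (5, 1, 5)] ->
  (i <= j)%N ->
  a * balancing i.+1 ^+ 2 + b * balancing j.+1 ^+ 2 + balancing (i + j).+1 ^+ 2
    <> d * balancing i.+1 * balancing j.+1 * balancing (i + j).+1.
Proof.
move=> h hij heq.
have x0 := balancingS_gt0 i; have y0 := balancingS_gt0 j.
have xy : balancing i.+1 <= balancing j.+1 by apply: balancing_le.
have zxy := balancing_addS_le i j.
case: i => [|i] in hij x0 xy zxy heq *.
  (* Here [x = 1] and [z = y], leaving [a + (b + 1)y^2 = dy^2]. *)
  rewrite add0n (_ : balancing 1 = 1) // in heq.
  move: y0 heq; set y := balancing _ => y0 heq.
  have [ey|y2] : y = 1 \/ 2 <= y by lia.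
    by move: h heq; rewrite ey !inE => /or4P[] /eqP[-> -> ->].
  have : 2 * 2 <= y ^+ 2 by nia.
  by move: h heq; rewrite !inE => /or4P[] /eqP[-> -> ->]; lia.
have zy : 5 * balancing j.+1 <= balancing (i.+1 + j).+1.
  have : balancing j.+2 <= balancing (i.+1 + j).+1 by apply: balancing_le; lia.
  by have := balancing_ratio j.+1; lia.
have x6 : 6 <= balancing i.+2 by apply: (@balancing_le 2).
move: heq xy x0 y0 zy x6 zxy.
set x := balancing i.+2; set y := balancing j.+1.
set z := balancing (i.+1 + j).+1.
move=> heq xy x0 y0 zy x6 zxy.
have h2 : x ^+ 2 <= y ^+ 2 by nia.
have h3 : 0 < y ^+ 2 by apply: exprn_gt0.
have h4 : 6 * y <= x * y by nia.
have h5 : 5 * y * (6 * y) <= z * (x * y) by apply: ler_pM; lia.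
have h6 : z * z <= z * (x * y) by nia.
by move: h heq; rewrite !inE => /or4P[] /eqP[-> -> ->]; lia.
Qed.

(** * Sorting the indices, with [a, b, c] permuted alongside and [d] fixed *)

Definition markov_perms : seq (int * int * int * int) :=
  [seq (s`_0, s`_1, s`_2, t.2) | t <- markov_coefs,
    s <- permutations [:: t.1.1.1; t.1.1.2; t.1.2]].

(** The second condition serves [balancing_ne_large], the third [balancing_ne_small]; the last
    selects the argument for [k = i + j]. *)
Lemma markov_permsP a b c d : (a, b, c, d) \in markov_perms ->
  [/\ [/\ 0 < a, 0 < b & 0 < c],
      d <= 5 * c \/ [/\ c = 1, d = 6, a <= 3 & b <= 3],
      a + b + c < 5 * d &
      [\/ d = a + b + c,
          [/\ a = 1, b = 1, d = c & c \in [:: 1; 2; 5]] |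
          c = 1 /\ (a, b, d) \in [:: (1, 2, 2); (2, 1, 2); (1, 5, 5); (5, 1, 5)]]].
Proof.
(* A boolean mirror of the claim lets computation check the whole list. *)
pose P (t : int * int * int * int) := let: (a, b, c, d) := t in
  [&& [&& 0 < a, 0 < b & 0 < c],
      (d <= 5 * c) || [&& c == 1, d == 6, a <= 3 & b <= 3],
      a + b + c < 5 * d &
      [|| d == a + b + c,
          [&& a == 1, b == 1, d == c & c \in [:: 1; 2; 5]] |
          (c == 1) &&
          ((a, b, d) \in [:: (1, 2, 2); (2, 1, 2); (1, 5, 5); (5, 1, 5)])]].
have /allP allP_perms : all P markov_perms by vm_compute.
move=> /allP_perms /and4P[/and3P[a0 b0 c0] hd hs hr]; split=> //.
  by case/orP: hd => [|/and4P[/eqP ? /eqP ? ? ?]]; [left | right].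
case/or3P: hr => [/eqP ?|/and4P[/eqP ? /eqP ? /eqP ? ?]|/andP[/eqP ? ?]].
- by apply: Or31.
- by apply: Or32.
- by apply: Or33.
Qed.

Lemma markov_balancing_sorted a b c d i j k :
  (a, b, c, d) \in markov_perms -> (0 < i)%N -> (i <= j)%N -> (j <= k)%N ->
  a * balancing i ^+ 2 + b * balancing j ^+ 2 + c * balancing k ^+ 2
    = d * balancing i * balancing j * balancing k ->
  [/\ balancing i = 1, balancing j = 1 & balancing k = 1].
Proof.
case: i j k => [|i] [|j] [|k] // /markov_permsP[[a0 b0 c0] hd hs hr] _ hij hjk heq.
have ijk : (i <= j <= k)%N by apply/andP.
have {}hij : (i <= j)%N by [].
suff z1 : balancing k.+1 = 1.
  have := balancing_le i.+1 j.+1 hij; have := balancing_le j.+1 k.+1 hjk.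
  by have := balancingS_gt0 i; split; lia.
have [hk|hk] := ltnP (i + j) k.
  by case: (balancing_ne_large _ _ _ _ _ _ _ a0 b0 c0 hd hij hk heq).
case: hr => [hr|hr|hr].
- exact: (markov_balancing_mid _ _ _ _ _ _ _ a0 b0 c0 hr ijk hk heq).
- move: hk; rewrite leq_eqVlt => /orP[/eqP ek|hk]; last first.
    by case: (balancing_ne_small _ _ _ _ _ _ _ a0 b0 c0 hs ijk hk heq).
  case: hr heq => -> -> -> hc; rewrite ek !mul1r => heq.
  by case: (balancing_ne_diag_eq _ _ _ hc hij heq).
- move: hk; rewrite leq_eqVlt => /orP[/eqP ek|hk]; last first.
    by case: (balancing_ne_small _ _ _ _ _ _ _ a0 b0 c0 hs ijk hk heq).
  case: hr heq => -> habd; rewrite ek !mul1r => heq.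
  by case: (balancing_ne_diag_lt _ _ _ _ _ habd hij heq).
Qed.

Theorem theorem4 (a b c d : int) (habcd : (a, b, c, d) \in markov_coefs)
    (x y z : int) (i j k : nat)
    (hi : (1 <= i)%N) (hj : (1 <= j)%N) (hk : (1 <= k)%N)
    (hx : x = balancing i) (hy : y = balancing j) (hz : z = balancing k)
    (heq : a * x ^+ 2 + b * y ^+ 2 + c * z ^+ 2 = d * x * y * z) :
  [/\ x = y, y = z, z = balancing 1 & balancing 1 = 1].
Proof.
suff [-> -> ->] : [/\ x = 1, y = 1 & z = 1] by [].
have sorted a' b' c' i' j' k' :
    perm_eq [:: a'; b'; c'] [:: a; b; c] ->
    (0 < i')%N -> (i' <= j')%N -> (j' <= k')%N ->
    a' * balancing i' ^+ 2 + b' * balancing j' ^+ 2 + c' * balancing k' ^+ 2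
      = d * balancing i' * balancing j' * balancing k' ->
    [/\ balancing i' = 1, balancing j' = 1 & balancing k' = 1].
  move=> hs; apply: markov_balancing_sorted.
  apply/allpairsPdep; exists (a, b, c, d), [:: a'; b'; c'].
  by rewrite mem_permutations.
subst x y z.
(* Of the eight outcomes, the two cyclic ones are absorbed by the orders [i <= j <= k] and
   [k <= j <= i]. *)
have [hij|/ltnW hij] := leqP i j; have [hjk|/ltnW hjk] := leqP j k;
  have [hik|/ltnW hik] := leqP i k.
1,2: by apply: (sorted a b c).
- by case: (sorted a c b i k j) => //; [apply/permP => q /=; lia | lia].
- by case: (sorted c a b k i j) => //; [apply/permP => q /=; lia | lia].
- by case: (sorted b a c j i k) => //; [apply/permP => q /=; lia | lia].
- by case: (sorted b c a j k i) => //; [apply/permP => q /=; lia | lia].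
all: by case: (sorted c b a k j i) => //; [apply/permP => q /=; lia | lia].
Qed.
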